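(* Let $W_0$ be an entanglement witness on $\mathcal{H}_d\otimes\mathcal{H}_d$, where $\mathcal{H}_d$ is a $d$-dimensional complex Hilbert space, and let $$b=\sqrt{\operatorname{Tr}(W_0^\dagger W_0)-\frac{(\operatorname{Tr}W_0)^2}{d^2}}.$$ Then for every state $\rho_{AB}$ on $\mathcal{H}_d\otimes\mathcal{H}_d$, $$D_{sep}(\rho_{AB})\ge-\frac{1}{b}\operatorname{Tr}(W_0\rho_{AB}).$$
   Context: A state is a positive semidefinite operator of trace one. A state $\sigma$ on $\mathcal{H}_A\otimes\mathcal{H}_B$ (here $\mathcal{H}_A=\mathcal{H}_B=\mathcal{H}_d$) is separable if $\sigma=\sum_i p_i\,\rho_A^i\otimes\rho_B^i$ for a (finite) probability distribution $\{p_i\}$ and states $\rho_A^i,\rho_B^i$ of the subsystems; $Sep(A:B)$ is the set of separable states. An entanglement witness is a Hermitian operator (observable) $W_0$ with $\operatorname{Tr}(W_0\sigma)\ge0$ for every separable state $\sigma$ and $\operatorname{Tr}(W_0\rho)<0$ for some entangled (i.e. non-separable) state $\rho$. $\|A\|_F=\sqrt{\operatorname{Tr}(A^\dagger A)}$ is the Frobenius norm, and $D_{sep}(\rho)=\min_{\sigma\in Sep(A:B)}\|\rho-\sigma\|_F$. *)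

(* Defs.v *)
From HB Require Import structures.
From mathcomp Require Import all_boot all_order all_algebra.
From mathcomp Require Import spectral complex mxtens.
From mathcomp Require Import classical_sets reals.

Set Implicit Arguments.
Unset Strict Implicit.
Unset Printing Implicit Defensive.

Import Order.TTheory GRing.Theory Num.Theory.
Local Open Scope ring_scope.
Local Open Scope complex_scope.
Local Open Scope sesquilinear_scope.
Local Open Scope classical_set_scope.

(* Operators on C^n are n x n matrices over R[i]; operators on C^d (x) C^d are
   (d * d) x (d * d) matrices, and A *t B is the Kronecker product.
   On R[i], x <= y means that y - x is a nonnegative real number. *)

Definition psdmx (R : realType) (n : nat) (A : 'M[R[i]]_n) : Prop :=
  A \is hermsymmx /\
  forall v : 'cV[R[i]]_n, 0 <= (v ^t* *m A *m v) ord0 ord0.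

Definition state (R : realType) (n : nat) (rho : 'M[R[i]]_n) : Prop :=
  psdmx rho /\ \tr rho = 1.

Definition separable_state (R : realType) (d : nat)
    (sigma : 'M[R[i]]_(d * d)) : Prop :=
  exists (n : nat) (p : 'I_n -> R) (rhoA rhoB : 'I_n -> 'M[R[i]]_d),
    [/\ forall i, 0 <= p i,
        \sum_(i < n) p i = 1,
        forall i, state (rhoA i),
        forall i, state (rhoB i) &
        sigma = \sum_(i < n) (p i)%:C *: (rhoA i *t rhoB i)].

Definition entanglement_witness (R : realType) (d : nat)
    (W : 'M[R[i]]_(d * d)) : Prop :=
  [/\ W \is hermsymmx,
      forall sigma : 'M[R[i]]_(d * d),
        separable_state sigma -> 0 <= \tr (W *m sigma) &
      exists rho : 'M[R[i]]_(d * d),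
        [/\ state rho, ~ separable_state rho & \tr (W *m rho) < 0]].

(* \tr (A ^t* *m A) is a nonnegative real, hence so is its sqrtC; Re only
   changes the type from R[i] to R. *)
Definition frobenius (R : realType) (m n : nat) (A : 'M[R[i]]_(m, n)) : R :=
  complex.Re (sqrtC (\tr (A ^t* *m A))).

(* The minimum of the distances to separable states, written as an infimum:
   it is attained because the set of separable states is compact.  That set is
   nonempty for 0 < d; for d = 0 there are no states at all. *)
Definition Dsep (R : realType) (d : nat) (rho : 'M[R[i]]_(d * d)) : R :=
  inf [set frobenius (rho - sigma) |
        sigma in [set s : 'M[R[i]]_(d * d) | separable_state s]].

(* Main.v *)
(** A Hermitian [W] defines a functional [rho |-> tr (W rho)] on which scalar
    shifts of [W] only add constants along states.  The shift [c = tr W / d^2]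
    makes [W - c I] traceless and brings its Frobenius norm down to [b].
    Cauchy-Schwarz for [W - c I] and [rho - sigma], with [sigma] separable,
    then gives [- tr (W rho) <= tr (W sigma) - tr (W rho) <= b |rho - sigma|]. *)

Require Import Defs.
From HB Require Import structures.
From mathcomp Require Import all_boot all_order all_algebra.
From mathcomp Require Import spectral complex mxtens.
From mathcomp Require Import classical_sets reals.

Set Implicit Arguments.
Unset Strict Implicit.
Unset Printing Implicit Defensive.

Import Order.TTheory GRing.Theory Num.Theory.
Local Open Scope ring_scope.
Local Open Scope sesquilinear_scope.

Section FrobeniusDot.
Variable C : numClosedFieldType.

Local Notation mxdot_def := (form_of_matrix Num.conj 1%:M).
(** The Hilbert-Schmidt inner product, encoded as the sesquilinear form with identity Gram matrix so
    that its bilinear and Hermitian structures are inherited; only positivity remains before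
    Cauchy-Schwarz applies. *)
Definition mxdot m n (A B : 'M[C]_(m, n)) := mxdot_def A%R B%R.

HB.instance Definition _ m n := Bilinear.copy (@mxdot m n) mxdot_def.
HB.instance Definition _ m n := Hermitian.copy (@mxdot m n) mxdot_def.

Lemma mxdotE m n (A B : 'M[C]_(m, n)) : mxdot A B = \tr (A *m B ^t* ).
Proof. by rewrite /mxdot /form_of_matrix mulmx1. Qed.

Lemma mxdot_sum m n (A B : 'M[C]_(m, n)) :
  mxdot A B = \sum_i \sum_j A i j * (B i j)^*.
Proof.
rewrite mxdotE; apply: eq_bigr => i _; rewrite mxE.
by apply: eq_bigr => j _; rewrite !mxE.
Qed.

(** The form is a sum of squared moduli of entries, so it can vanish only if every entry does. *)
Fact mxdot_is_dotmx m n (A : 'M[C]_(m, n)) : A != 0 -> 0 < mxdot A A.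
Proof.
move=> A_neq0; rewrite mxdot_sum.
have ge0 i j : 0 <= A i j * (A i j)^* by exact: mul_conjC_ge0.
have sge0 i : 0 <= \sum_j A i j * (A i j)^* by exact: sumr_ge0.
rewrite lt0r sumr_ge0// andbT; apply: contraNneq A_neq0 => /psumr_eq0P A0.
apply/eqP/matrixP => i j; rewrite mxE.
have /psumr_eq0P Ai0 := A0 (fun i _ => sge0 i) i isT.
by apply/eqP; rewrite -mul_conjC_eq0 (Ai0 (fun j _ => ge0 i j)).
Qed.

HB.instance Definition _ m n := isDotProduct.Build _ _ (@mxdot m n)
  (@mxdot_is_dotmx m n).

Lemma trace_CauchySchwarz m n (A B : 'M[C]_(m, n)) :
  `|\tr (A ^t* *m B)| <= sqrtC (\tr (A ^t* *m A)) * sqrtC (\tr (B ^t* *m B)).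
Proof.
(* Cyclicity moves the adjoint to the right, which makes the left side [mxdot B A], with the
   arguments swapped. *)
rewrite !(mxtrace_mulC (_ ^t* )) -!mxdotE mulrC.
by have [] := CauchySchwarz_sqrt (@mxdot m n) B A.
Qed.

Lemma trace_adjmx n (A : 'M[C]_n) : \tr (A ^t* ) = (\tr A)^*.
Proof. by rewrite trace_map_mx mxtrace_tr. Qed.

Lemma hermsymmxE n (A : 'M[C]_n) : A \is hermsymmx -> A ^t* = A.
Proof. by move=> /is_hermitianmxP {2}->; rewrite expr0 scale1r. Qed.

Lemma hermsymmx_trace_real n (A : 'M[C]_n) :
  A \is hermsymmx -> \tr A \is Num.real.
Proof. by move=> /hermsymmxE Ah; rewrite CrealE -trace_adjmx Ah. Qed.

Lemma hermsymmx_trace_mul_real n (A B : 'M[C]_n) :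
  A \is hermsymmx -> B \is hermsymmx -> \tr (A *m B) \is Num.real.
Proof.
move=> /hermsymmxE Ah /hermsymmxE Bh.
by rewrite CrealE -trace_adjmx trmx_mul map_mxM/= Ah Bh mxtrace_mulC.
Qed.

Lemma adjmx_sub_scalar n (A : 'M[C]_n) c :
  A \is hermsymmx -> c \is Num.real -> (A - c%:M) ^t* = A - c%:M.
Proof.
move=> /hermsymmxE Ah /CrealP cc.
by rewrite linearB/= tr_scalar_mx map_mxB Ah map_scalar_mx/= cc.
Qed.

Lemma trace_mean_real n (A : 'M[C]_n) :
  A \is hermsymmx -> \tr A / n%:R \is Num.real.
Proof. by move=> Ah; rewrite realM ?realV ?realn ?hermsymmx_trace_real. Qed.

Lemma trace_centered_sqr n (A : 'M[C]_n) (c := \tr A / n%:R) :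
  (0 < n)%N -> A \is hermsymmx ->
  \tr ((A - c%:M) ^t* *m (A - c%:M)) = \tr (A ^t* *m A) - (\tr A) ^+ 2 / n%:R.
Proof.
move=> n_gt0 Ah; have n0 : n%:R != 0 :> C by rewrite pnatr_eq0 -lt0n.
rewrite adjmx_sub_scalar ?trace_mean_real// hermsymmxE//.
rewrite mulmxBl !mulmxBr mul_mx_scalar !mul_scalar_mx scale_scalar_mx.
rewrite !linearB/= !linearZ/= mxtrace_scalar.
(* As [c] is the mean eigenvalue, the constant term cancels one of the two cross terms [c * \tr A],
   as in the variance formula. *)
have -> : (c * c) *+ n = c * \tr A by rewrite -mulr_natr /c -!mulrA mulVf// mulr1.
by rewrite subrr subr0 /c expr2 mulrAC.
Qed.

End FrobeniusDot.

Lemma mxtrace_tens (R : pzRingType) m n (A : 'M[R]_m) (B : 'M[R]_n) :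
  \tr (A *t B) = \tr A * \tr B.
Proof. by rewrite /mxtrace mulr_sum; apply: eq_bigr => i _; rewrite mxE. Qed.

Local Open Scope complex_scope.
Local Open Scope sesquilinear_scope.

Section Separable.
Variable R : realType.

Lemma state_delta_mx n (i : 'I_n) : state (delta_mx i i : 'M[R[i]]_n).
Proof.
split; last first.
  rewrite /mxtrace (bigD1 i)//= mxE !eqxx big1 ?addr0// => j /negPf ji.
  by rewrite mxE ji.
split.
  by apply/is_hermitianmxP; rewrite expr0 scale1r trmx_delta map_delta_mx.
(* Factoring the matrix unit as a column times a row turns the quadratic form into the squared
   modulus of the [i]-th entry of [v]. *)
move=> v; rewrite -(mul_delta_mx (0 : 'I_1)) mulmxA -mulmxA.
rewrite -rowE -colE mxE big_ord1 !mxE mulrC; exact: mul_conjC_ge0.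
Qed.

Lemma separable_state_tens d (A B : 'M[R[i]]_d) :
  state A -> state B -> separable_state (A *t B).
Proof.
move=> sA sB; exists 1%N, (fun=> 1), (fun=> A), (fun=> B); split => //.
- by rewrite big_ord1.
- by rewrite big_ord1 scale1r.
Qed.

Lemma separable_state_trace d (s : 'M[R[i]]_(d * d)) :
  separable_state s -> \tr s = 1.
Proof.
move=> [n [p [A [B [_ p1 sA sB ->]]]]]; rewrite linear_sum/=.
under eq_bigr => i _.
  rewrite linearZ/= mxtrace_tens (sA i).2 (sB i).2 !mulr1; over.
by rewrite -raddf_sum p1.
Qed.

Lemma trace_adjmx_mul_ge0 m n (A : 'M[R[i]]_(m, n)) : 0 <= \tr (A ^t* *m A).
Proof. by rewrite mxtrace_mulC -mxdotE; exact: (dnorm_ge0 (@mxdot _ m n)). Qed.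

Lemma frobeniusE m n (A : 'M[R[i]]_(m, n)) :
  (frobenius A)%:C = sqrtC (\tr (A ^t* *m A)).
Proof. by rewrite RRe_real// sqrtC_real// trace_adjmx_mul_ge0. Qed.

Lemma state_dim_gt0 n (rho : 'M[R[i]]_n) : state rho -> (0 < n)%N.
Proof.
case: n rho => // rho [_ /eqP]; rewrite /mxtrace big_ord0 eq_sym.
by rewrite oner_eq0.
Qed.

(** A lower bound of a nonempty set is below its infimum. Realness of [x] lets the comparison in
    [R[i]] descend to [R]. *)
Lemma le_Dsep d (rho : 'M[R[i]]_(d * d)) (x : R[i]) :
  (0 < d)%N -> x \is Num.real ->
  (forall s, separable_state s -> x <= (frobenius (rho - s))%:C) ->
  x <= (Dsep rho)%:C.
Proof.
case: d rho => // d rho _ /RRe_real <- le_x; rewrite lecR.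
apply: lb_le_inf => [|_ [s ss <-]]; last by rewrite -lecR le_x.
(* Nonemptiness is witnessed by a pure product state on the first basis vectors, which exist because
   [d] is positive. *)
have s0 := state_delta_mx (0 : 'I_d.+1).
exists (frobenius (rho - delta_mx 0 0 *t delta_mx 0 0)).
by exists (delta_mx 0 0 *t delta_mx 0 0) => //; exact: separable_state_tens.
Qed.

End Separable.

Theorem mainTheorem3 (R : realType) (d : nat) (W0 : 'M[R[i]]_(d * d))
    (hW0 : entanglement_witness W0) :
  let b : R[i] := sqrtC (\tr (W0 ^t* *m W0) - (\tr W0) ^+ 2 / d%:R ^+ 2) in
  forall rhoAB : 'M[R[i]]_(d * d), state rhoAB ->
    - (1 / b) * \tr (W0 *m rhoAB) <= (Dsep rhoAB)%:C.
Proof.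
move=> b rho srho; have [Wh Wsep _] := hW0.
have dd0 := state_dim_gt0 srho.
have d0 : (0 < d)%N by move: dd0; rewrite muln_gt0 andbb.
pose V := W0 - (\tr W0 / (d * d)%:R)%:M.
have bE : b = sqrtC (\tr (V ^t* *m V)).
  by rewrite trace_centered_sqr// natrM -expr2.
have b0 : 0 <= b by rewrite bE sqrtC_ge0 trace_adjmx_mul_ge0.
have tr_real : \tr (W0 *m rho) \is Num.real.
  by apply: hermsymmx_trace_mul_real => //; case: srho => -[].
apply: le_Dsep => //.
  by rewrite realM// realN realM ?real1// realV ger0_real.
move=> s ss.
(* With the convention that the inverse of 0 is 0, the case [b = 0] reduces to nonnegativity of the
   norm. *)
have [->|bn0] := eqVneq b 0.
  by rewrite invr0 mulr0 oppr0 mul0r frobeniusE sqrtC_ge0 trace_adjmx_mul_ge0.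
have b_gt0 : 0 < b by rewrite lt0r bn0.
(* The scalar shift is invisible here because [rho - s] has trace zero. *)
have VWE : \tr (V *m (rho - s)) = \tr (W0 *m rho) - \tr (W0 *m s).
  rewrite mulmxBl mul_scalar_mx linearB/= linearZ/= mulmxBr !linearB/=.
  by rewrite srho.2 (separable_state_trace ss) subrr mulr0 subr0.
have Vh : V ^t* = V by rewrite adjmx_sub_scalar ?trace_mean_real.
have := trace_CauchySchwarz V (rho - s).
rewrite -bE -frobeniusE Vh VWE => CS.
rewrite mul1r mulNr -mulrN mulrC ler_pdivrMr// mulrC.
(* Adding the nonnegative [\tr (W0 *m s)] gives a real difference, which is at most its modulus. *)
apply: le_trans CS; rewrite distrC.
apply: le_trans (_ : \tr (W0 *m s) - \tr (W0 *m rho) <= _).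
  by rewrite lerDr Wsep.
by apply: real_ler_norm; rewrite realB// ger0_real// Wsep.
Qed.
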